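(* Let $M$ be a simple matroid of rank $\ell$ on $[n]$ and let $I=I(M)\subset E$ be its Orlik–Solomon ideal. Then the set $Z=\{z(T)\mid T\in\mathbf{nbc}_\ell\}$ generates the annihilator ideal $I^0$. In particular $I^0$ is a pure ideal.
   Context: $R$ is an arbitrary nonzero commutative ring with $1$. $M$ is a simple matroid (no loops, no nontrivial parallel classes) on $[n]=\{1,\dots,n\}$ of rank $\ell$. $E$ is the exterior algebra over $R$ on the free $R$-module with basis $e_1,\dots,e_n$, with the standard grading $E_p=\Lambda^p$. For $S=\{i_1<\dots<i_p\}\subset[n]$ put $e_S=e_{i_1}\cdots e_{i_p}$ ($e_\emptyset=1$). $\partial:E\to E$ is the $R$-linear map of degree $-1$ with $\partial e_i=1$ for all $i$ and $\partial(ab)=(\partial a)b+(-1)^{\deg a}a\,\partial b$ for homogeneous $a$ and all $b$. The Orlik–Solomon ideal $I=I(M)$ is the ideal of $E$ generated by $\partial e_S$ for all dependent sets $S$ of $M$. The annihilator is $I^0=\{a\in E\mid ab=0\text{ for every }b\in I\}$. An element of $E$ is pure if it is a product of elements of $E_1$; an ideal is pure if it is generated by a set of pure elements. A broken circuit is a circuit of $M$ with its smallest element deleted. A subset of $[n]$ is $\mathbf{nbc}$ if it contains no broken circuit; $\mathbf{nbc}_p$ is the set of $\mathbf{nbc}$-sets of cardinality $p$. $cl$ is the closure operator of $M$. Definition of $z(T)$ for $T=\{i_1<\dots<i_\ell\}\in\mathbf{nbc}_\ell$: put $X_0=\emptyset$, $X_p=cl(\{i_{\ell-p+1},\dots,i_\ell\})$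 and $S_p=X_p\setminus X_{p-1}$ for $1\le p\le \ell$. Then $S_1,\dots,S_\ell$ partition $[n]$ and $$z(T)=\mathrm{sign}(\sigma)\,\partial(e_{S_1})\partial(e_{S_2})\cdots\partial(e_{S_\ell}),$$ where $\sigma$ is the permutation of $[n]$ listing the elements of $S_1$ in increasing order, then those of $S_2$ in increasing order, and so on. *)

(* Defs.v *)
From HB Require Import structures.
From mathcomp Require Import classical_sets.
From mathcomp Require Import all_boot all_order all_algebra all_fingroup.

Set Implicit Arguments.
Unset Strict Implicit.
Unset Printing Implicit Defensive.

Import GRing.Theory.
Local Open Scope ring_scope.

(* The exterior algebra of the free module R^n, on its monomial basis:        *)
(* the element a stands for \sum_S a S *: e_S, where S ranges over the        *)
(* subsets of 'I_n and e_S is the increasing product of the e_i, i \in S      *)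
(* (ext_e_prod). The product is pinned down by ext_gen_sqr and                *)
(* ext_gen_anticomm.                                                          *)
Record ext (R : Type) (n : nat) := Ext { coefs :> {ffun {set 'I_n} -> R} }.
Arguments coefs : simpl never.
HB.instance Definition _ (R : Type) n := [isNew for @coefs R n].
HB.instance Definition _ (R : eqType) n := [Equality of ext R n by <:].
HB.instance Definition _ (R : choiceType) n := [Choice of ext R n by <:].

(* The number of pairs (i, j) of A x B that are out of order.                 *)
Definition inversions n (A B : {set 'I_n}) : nat :=
  \sum_(i in A) \sum_(j in B) (j < i)%N.

Section ExtModule.
Variables (R : comNzRingType) (n : nat).
Implicit Types (a b c : ext R n) (S A B : {set 'I_n}).

Lemma extP a b : (forall S, a S = b S) -> a = b.
Proof. by move=> eq_ab; apply/val_inj/ffunP. Qed.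

Definition ext0 : ext R n := Ext [ffun=> 0].
Definition ext_opp a : ext R n := Ext [ffun S => - a S].
Definition ext_add a b : ext R n := Ext [ffun S => a S + b S].
Definition ext_scale (k : R) a : ext R n := Ext [ffun S => k * a S].

Fact ext_addA : associative ext_add.
Proof. by move=> a b c; apply: extP => S; rewrite !ffunE addrA. Qed.
Fact ext_addC : commutative ext_add.
Proof. by move=> a b; apply: extP => S; rewrite !ffunE addrC. Qed.
Fact ext_add0 : left_id ext0 ext_add.
Proof. by move=> a; apply: extP => S; rewrite !ffunE add0r. Qed.
Fact ext_addN : left_inverse ext0 ext_opp ext_add.
Proof. by move=> a; apply: extP => S; rewrite !ffunE addNr. Qed.
HB.instance Definition _ :=
  GRing.isZmodule.Build (ext R n) ext_addA ext_addC ext_add0 ext_addN.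

Fact ext_scaleA k l a : ext_scale k (ext_scale l a) = ext_scale (k * l) a.
Proof. by apply: extP => S; rewrite !ffunE mulrA. Qed.
Fact ext_scale1 : left_id 1 ext_scale.
Proof. by move=> a; apply: extP => S; rewrite !ffunE mul1r. Qed.
Fact ext_scaleDr : right_distributive ext_scale +%R.
Proof. by move=> k a b; apply: extP => S; rewrite !ffunE mulrDr. Qed.
Fact ext_scaleDl a : {morph ext_scale^~ a : k l / k + l}.
Proof. by move=> k l; apply: extP => S; rewrite !ffunE mulrDl. Qed.
HB.instance Definition _ := GRing.Zmodule_isLmodule.Build R (ext R n)
  ext_scaleA ext_scale1 ext_scaleDr ext_scaleDl.

Definition ext_e S : ext R n := Ext [ffun A => (A == S)%:R].

(* e_A e_B is 0 unless A and B are disjoint, in which case it is              *)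
(* (-1)^(inversions A B) e_(A U B).                                           *)
Definition ext_mul a b : ext R n :=
  \sum_(A : {set 'I_n}) \sum_(B : {set 'I_n} | [disjoint A & B])
    ((-1) ^+ inversions A B * (a A * b B)) *: ext_e (A :|: B).

Lemma ext0E S : (0 : ext R n) S = 0. Proof. by rewrite ffunE. Qed.
Lemma extDE a b S : (a + b) S = a S + b S. Proof. by rewrite ffunE. Qed.
Lemma extNE a S : (- a) S = - a S. Proof. by rewrite ffunE. Qed.
Lemma extZE k a S : (k *: a) S = k * a S. Proof. by rewrite ffunE. Qed.
Lemma ext_eE S A : ext_e S A = (A == S)%:R. Proof. by rewrite ffunE. Qed.
Lemma ext_sumE I (r : seq I) (P : pred I) (F : I -> ext R n) S :
  (\sum_(i <- r | P i) F i) S = \sum_(i <- r | P i) F i S.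
Proof. by elim/big_rec2: _ => [|i _ y _ <-]; rewrite ?ext0E ?extDE. Qed.

Lemma ext_basis a : a = \sum_(S : {set 'I_n}) a S *: ext_e S.
Proof.
apply: extP => S; rewrite ext_sumE (bigD1 S) //= extZE ext_eE eqxx mulr1.
by rewrite big1 ?addr0 // => A nAS; rewrite extZE ext_eE eq_sym (negPf nAS) mulr0.
Qed.

Fact ext_mulDl : left_distributive ext_mul +%R.
Proof.
move=> a b c; rewrite /ext_mul -big_split /=; apply: eq_bigr => A _.
rewrite -big_split /=; apply: eq_bigr => B _.
by rewrite extDE mulrDl mulrDr scalerDl.
Qed.
Fact ext_mulDr : right_distributive ext_mul +%R.
Proof.
move=> a b c; rewrite /ext_mul -big_split /=; apply: eq_bigr => A _.
rewrite -big_split /=; apply: eq_bigr => B _.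
by rewrite extDE !mulrDr scalerDl.
Qed.
Fact ext_mulZl k a b : k *: ext_mul a b = ext_mul (k *: a) b.
Proof.
rewrite /ext_mul scaler_sumr; apply: eq_bigr => A _.
rewrite scaler_sumr; apply: eq_bigr => B _.
by rewrite extZE scalerA mulrCA !mulrA.
Qed.
Fact ext_mulZr k a b : k *: ext_mul a b = ext_mul a (k *: b).
Proof.
rewrite /ext_mul scaler_sumr; apply: eq_bigr => A _.
rewrite scaler_sumr; apply: eq_bigr => B _.
by rewrite extZE scalerA mulrCA (mulrCA k).
Qed.
Lemma ext_mul0l b : ext_mul 0 b = 0.
Proof. by apply: (addrI (ext_mul 0 b)); rewrite -ext_mulDl !addr0. Qed.
Lemma ext_mul0r a : ext_mul a 0 = 0.
Proof. by apply: (addrI (ext_mul a 0)); rewrite -ext_mulDr !addr0. Qed.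
Lemma ext_mul_suml I (r : seq I) (P : pred I) (F : I -> ext R n) b :
  ext_mul (\sum_(i <- r | P i) F i) b = \sum_(i <- r | P i) ext_mul (F i) b.
Proof.
by apply: (big_morph (ext_mul^~ b)) => [x y|]; rewrite ?ext_mulDl ?ext_mul0l.
Qed.
Lemma ext_mul_sumr I (r : seq I) (P : pred I) (F : I -> ext R n) a :
  ext_mul a (\sum_(i <- r | P i) F i) = \sum_(i <- r | P i) ext_mul a (F i).
Proof.
by apply: (big_morph (ext_mul a)) => [x y|]; rewrite ?ext_mulDr ?ext_mul0r.
Qed.

Lemma ext_mul_e A B : ext_mul (ext_e A) (ext_e B) =
  if [disjoint A & B] then (-1) ^+ inversions A B *: ext_e (A :|: B) else 0.
Proof.
rewrite /ext_mul (bigD1 A) //= [X in _ + X]big1 => [|A' nA]; last first.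
  by rewrite big1 // => B' _; rewrite ext_eE (negPf nA) mul0r mulr0 scale0r.
rewrite addr0; case: ifP => dAB; last first.
  rewrite big1 // => B' dAB'; rewrite !ext_eE.
  have [eB|] := eqVneq B' B; first by rewrite eB dAB in dAB'.
  by rewrite !mulr0 scale0r.
rewrite (bigD1 B) //= big1 => [|B' /andP[_ nB]]; last first.
  by rewrite !ext_eE (negPf nB) !mulr0 scale0r.
by rewrite !ext_eE !eqxx !mulr1 addr0.
Qed.

Lemma inversionsUl A B (C : {set 'I_n}) : [disjoint A & B] ->
  inversions (A :|: B) C = (inversions A C + inversions B C)%N.
Proof.
move=> dAB; rewrite /inversions -bigU //.
by apply: eq_bigl => i; rewrite in_setU.
Qed.
Lemma inversionsUr A B (C : {set 'I_n}) : [disjoint B & C] ->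
  inversions A (B :|: C) = (inversions A B + inversions A C)%N.
Proof.
move=> dBC; rewrite /inversions -big_split /=.
apply: eq_bigr => i _; rewrite -bigU //.
by apply: eq_bigl => j; rewrite in_setU.
Qed.
Lemma inversions0l A : inversions set0 A = 0%N.
Proof. by rewrite /inversions big_set0. Qed.
Lemma inversions0r A : inversions A set0 = 0%N.
Proof. by rewrite /inversions big1 // => i _; rewrite big_set0. Qed.

Lemma disjoint_setUl A B (C : {set 'I_n}) :
  [disjoint A :|: B & C] = [disjoint A & C] && [disjoint B & C].
Proof. by rewrite !disjoints_subset subUset. Qed.
Lemma disjoint_setUr A B (C : {set 'I_n}) :
  [disjoint A & B :|: C] = [disjoint A & B] && [disjoint A & C].
Proof. by rewrite disjoint_sym disjoint_setUl !(disjoint_sym A). Qed.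

Fact ext_mulA : associative ext_mul.
Proof.
have eA A B C : ext_mul (ext_e A) (ext_mul (ext_e B) (ext_e C)) =
                ext_mul (ext_mul (ext_e A) (ext_e B)) (ext_e C).
  rewrite !ext_mul_e; case dBC: [disjoint B & C]; case dAB: [disjoint A & B];
    rewrite ?ext_mul0l ?ext_mul0r -?ext_mulZr -?ext_mulZl ?ext_mul_e;
    rewrite ?disjoint_setUl ?disjoint_setUr ?dAB ?dBC ?andbF ?scaler0 //=.
  rewrite andbT; case: ifP => dAC; last by rewrite !scaler0.
  rewrite !scalerA -!exprD setUA inversionsUl // inversionsUr //.
  by congr (_ ^+ _ *: _); rewrite addnC addnA.
have eAB A B c : ext_mul (ext_e A) (ext_mul (ext_e B) c) =
                 ext_mul (ext_mul (ext_e A) (ext_e B)) c.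
  rewrite [c]ext_basis (ext_mul_sumr _ _ _ (ext_e B)).
  rewrite (ext_mul_sumr _ _ _ (ext_e A)) (ext_mul_sumr _ _ _ (ext_mul _ _)).
  by apply: eq_bigr => C _; rewrite -!ext_mulZr eA.
have eAb A b c : ext_mul (ext_e A) (ext_mul b c) =
                 ext_mul (ext_mul (ext_e A) b) c.
  rewrite [b]ext_basis (ext_mul_suml _ _ _ c) !(ext_mul_sumr _ _ _ (ext_e A)).
  rewrite (ext_mul_suml _ _ _ c).
  by apply: eq_bigr => B _; rewrite -ext_mulZl -!ext_mulZr -ext_mulZl eAB.
move=> a b c; rewrite [a]ext_basis (ext_mul_suml _ _ _ (ext_mul b c)).
rewrite (ext_mul_suml _ _ _ b) (ext_mul_suml _ _ _ c).
by apply: eq_bigr => A _; rewrite -!ext_mulZl eAb.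
Qed.
Fact ext_mul1l : left_id (ext_e set0) ext_mul.
Proof.
move=> a; rewrite [a]ext_basis ext_mul_sumr; apply: eq_bigr => A _.
by rewrite -ext_mulZr ext_mul_e disjoints_subset sub0set inversions0l
           set0U scale1r.
Qed.
Fact ext_mul1r : right_id (ext_e set0) ext_mul.
Proof.
move=> a; rewrite [a]ext_basis ext_mul_suml; apply: eq_bigr => A _.
by rewrite -ext_mulZl ext_mul_e disjoint_sym disjoints_subset sub0set
           inversions0r setU0 scale1r.
Qed.
Fact ext_1_neq0 : ext_e set0 != 0.
Proof.
by apply/eqP => /(congr1 (fun a : ext R n => a set0)); rewrite ext_eE ext0E eqxx;
   apply/eqP/oner_neq0.
Qed.
HB.instance Definition _ := GRing.Zmodule_isNzRing.Build (ext R n)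
  ext_mulA ext_mul1l ext_mul1r ext_mulDl ext_mulDr ext_1_neq0.
HB.instance Definition _ :=
  GRing.Lmodule_isLalgebra.Build R (ext R n) ext_mulZl.
HB.instance Definition _ :=
  GRing.Lalgebra_isAlgebra.Build R (ext R n) ext_mulZr.

End ExtModule.
Arguments ext_e {R n} S.

Section Grading.
Variables (R : comNzRingType) (n : nat).
Implicit Types (a b : ext R n) (S : {set 'I_n}) (i j : 'I_n) (p : nat).

Definition ext_gen i : ext R n := ext_e [set i].

Definition grade p : set (ext R n) :=
  fun a => forall S, a S != 0 -> #|S| = p.

(* By bd_gen, bd_leibniz and bd_unique, bd is the unique linear map with      *)
(* bd e_i = 1 that satisfies the graded Leibniz rule.                         *)
Definition bd_e S : ext R n :=
  \sum_(i in S) (-1) ^+ #|[set j in S | (j < i)%N]| *: ext_e (S :\ i).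
Definition bd a : ext R n := \sum_(S : {set 'I_n}) a S *: bd_e S.

Fact bd_linear : linear bd.
Proof.
move=> k a b; rewrite /bd scaler_sumr -big_split /=; apply: eq_bigr => S _.
by rewrite extDE extZE scalerDl scalerA.
Qed.
HB.instance Definition _ :=
  GRing.isLinear.Build R (ext R n) (ext R n) _ bd bd_linear.

Lemma ext_e_mul (A B : {set 'I_n}) : ext_e A * ext_e B =
  if [disjoint A & B] then (-1) ^+ inversions A B *: ext_e (A :|: B)
  else 0 :> ext R n.
Proof. exact: ext_mul_e. Qed.

Lemma grade_e S : grade #|S| (ext_e S).
Proof.
by move=> A; rewrite ext_eE; have [->|] := eqVneq A S; rewrite ?eqxx.
Qed.

Lemma bd_on_e S : bd (ext_e S) = bd_e S.
Proof.
rewrite /bd (bigD1 S) //= big1 => [|A nA]; last first.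
  by rewrite ext_eE (negPf nA) scale0r.
by rewrite ext_eE eqxx scale1r addr0.
Qed.

Lemma bd_basis a : bd a = \sum_(S : {set 'I_n}) a S *: bd (ext_e S).
Proof. by apply: eq_bigr => S _; rewrite bd_on_e. Qed.

Lemma inversions1l i S : inversions [set i] S = #|[set j in S | (j < i)%N]|.
Proof.
rewrite /inversions big_set1 -sum1_card [RHS](eq_bigl
  (fun j => (j \in S) && (j < i)%N)) => [|j]; last by rewrite inE.
by rewrite big_mkcondr /=; apply: eq_bigr => j _; case: (j < i)%N.
Qed.

Lemma inversions_pair i j :
  i != j -> (inversions [set i] [set j] + inversions [set j] [set i] = 1)%N.
Proof.
by rewrite /inversions !big_set1 -(inj_eq val_inj) /=; case: ltngtP.
Qed.

Lemma bd_eE S :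
  bd_e S = \sum_(i in S) (-1) ^+ inversions [set i] (S :\ i) *: ext_e (S :\ i).
Proof.
apply: eq_bigr => i iS; rewrite inversions1l; congr (_ ^+ _ *: _).
apply: eq_card => j; rewrite !inE; case: eqP => // ->.
by rewrite ltnn andbF.
Qed.

Lemma ext_gen_e i S : ext_gen i * ext_e S =
  if i \in S then 0 else (-1) ^+ inversions [set i] S *: ext_e (i |: S).
Proof.
by rewrite /ext_gen ext_e_mul disjoints_subset sub1set inE; case: (i \in S).
Qed.

Lemma ext_gen_sqr i : ext_gen i * ext_gen i = 0.
Proof. by rewrite ext_gen_e set11. Qed.
Lemma ext_gen_anticomm i j : ext_gen i * ext_gen j = - (ext_gen j * ext_gen i).
Proof.
have [->|nij] := eqVneq i j; first by rewrite ext_gen_sqr oppr0.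
rewrite !ext_gen_e !inE (negPf nij) eq_sym (negPf nij) setUC -scaleNr.
move: (inversions_pair nij).
move: (inversions [set i] [set j]) (inversions [set j] [set i]).
by move=> [|[|k]] [|[|m]] //= _; rewrite ?expr1 ?expr0 ?opprK.
Qed.
Lemma ext_eS i S : i \in S ->
  ext_e S = (-1) ^+ inversions [set i] (S :\ i) *: (ext_gen i * ext_e (S :\ i)).
Proof.
move=> iS; rewrite ext_gen_e !inE eqxx /= setD1K // scalerA.
by rewrite -expr2 sqrr_sign scale1r.
Qed.
Lemma ext_e_prod S : ext_e S = \prod_(i <- enum S) ext_gen i.
Proof.
have sorted_S : sorted (fun i j : 'I_n => i < j)%N (enum S).
  rewrite {1}/enum_mem -enumT; apply: sorted_filter.
    by move=> x y w; apply: ltn_trans.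
  by have := iota_ltn_sorted 0 n; rewrite -val_enum_ord sorted_map.
rewrite -{1}[S]set_enum.
elim: (enum S) sorted_S => [_|i s IHs /= path_s].
  by rewrite big_nil; congr (ext_e _); apply/setP => i; rewrite !inE.
have lt_i j : j \in s -> (i < j)%N.
  have lt_trans : transitive (fun i j : 'I_n => i < j)%N.
    by move=> x y w; apply: ltn_trans.
  by move=> js; have /allP := order_path_min lt_trans path_s; apply.
have nis : i \notin s by apply/negP => /lt_i; rewrite ltnn.
rewrite big_cons -IHs ?(path_sorted path_s) // ext_gen_e inE (negPf nis).
rewrite set_cons inversions1l (_ : [set j in _ | _] = set0).
  by rewrite cards0 scale1r.
by apply/setP => j; rewrite !inE; apply/andP => -[/lt_i/ltnW]; rewrite leqNgt => /negP.
Qed.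

Lemma bd_gen i : bd (ext_gen i) = 1.
Proof.
rewrite bd_on_e bd_eE big_set1 setDv inversions1l (_ : [set j in _ | _] = set0).
  by rewrite cards0 scale1r.
by apply/setP => j; rewrite !inE.
Qed.

Lemma bd_one : bd 1 = 0.
Proof. by rewrite bd_on_e /bd_e big_set0. Qed.

Lemma bd_genM i a : bd (ext_gen i * a) = a - ext_gen i * bd a.
Proof.
have -> : ext_gen i * a = \sum_(S : {set 'I_n}) a S *: (ext_gen i * ext_e S).
  by rewrite {1}[a]ext_basis mulr_sumr; apply: eq_bigr => S _; rewrite -scalerAr.
rewrite (linear_sum bd) bd_basis {2}[a]ext_basis mulr_sumr -sumrB.
apply: eq_bigr => S _; rewrite linearZ /= -scalerAr -scalerBr.
congr (_ *: _); rewrite bd_on_e ext_gen_e bd_eE mulr_sumr.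
case: ifP => iS.
  rewrite linear0 (bigD1 i) //= big1 => [|j /andP[jS nji]]; last first.
    by rewrite -scalerAr ext_gen_e !inE eq_sym nji iS scaler0.
  by rewrite addr0 -scalerAr -ext_eS // subrr.
rewrite linearZ /= bd_on_e bd_eE big_setU1 ?iS //= setU1K ?iS //.
rewrite scalerDr scalerA -expr2 sqrr_sign scale1r.
congr (_ + _); rewrite scaler_sumr -sumrN; apply: eq_bigr => j jS.
have nji : j != i by apply: contraFneq iS => <-.
have Dij : (i |: S) :\ j = i |: S :\ j.
  by apply/setP => k; rewrite !inE; case: (k =P i) => // ->; rewrite eq_sym nji.
have niSj : i \notin S :\ j by rewrite inE iS andbF.
have djS : [disjoint [set j] & S :\ j].
  by rewrite disjoints_subset sub1set !inE eqxx.
have diS : [disjoint [set i] & S :\ j] by rewrite disjoints_subset sub1set inE.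
rewrite -scalerAr ext_gen_e (negPf niSj) Dij !scalerA -scaleNr.
congr (_ *: _); rewrite -[S in inversions [set i] S](setD1K jS).
rewrite !inversionsUr // -!exprD addnACA [X in (X + _)%N]addnC.
by rewrite (inversions_pair nji) exprS mulN1r addnC.
Qed.

Lemma bd_leibniz_e S b :
  bd (ext_e S * b) = bd (ext_e S) * b + (-1) ^+ #|S| *: (ext_e S * bd b).
Proof.
move: {2}#|S| (erefl #|S|) => k; elim: k S => [|k IHk] S cardS.
  by rewrite (cards0_eq cardS) !mul1r bd_one mul0r add0r cards0 scale1r.
have /card_gt0P[i iS] : (0 < #|S|)%N by rewrite cardS.
have cardSi : #|S :\ i| = k by rewrite (cardsD1 i) iS in cardS; case: cardS.
rewrite (ext_eS iS) -!scalerAl !linearZ /= -scalerAl.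
rewrite -scalerDr; congr (_ *: _); rewrite -mulrA !bd_genM IHk // mulrBl cardS exprS mulN1r scaleNr.
by rewrite mulrDr opprD -scalerAr cardSi -!mulrA addrA.
Qed.

Lemma bd_leibniz p a b : grade p a ->
  bd (a * b) = bd a * b + (-1) ^+ p *: (a * bd b).
Proof.
move=> gr_a.
have mul_a c : a * c = \sum_(S : {set 'I_n}) a S *: (ext_e S * c).
  by rewrite {1}[a]ext_basis mulr_suml; apply: eq_bigr => S _; rewrite -scalerAl.
rewrite !mul_a (linear_sum bd) (bd_basis a) mulr_suml scaler_sumr -big_split.
apply: eq_bigr => S _ /=; rewrite linearZ /= bd_leibniz_e -scalerAl.
have [->|/gr_a <-] := eqVneq (a S) 0.
  by rewrite !scale0r scaler0 addr0.
by rewrite scalerDr !scalerA mulrC.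
Qed.

Lemma bd_unique (d : {linear ext R n -> ext R n}) :
    (forall i, d (ext_gen i) = 1) ->
    (forall p a b, grade p a ->
       d (a * b) = d a * b + (-1) ^+ p *: (a * d b)) ->
  d =1 bd.
Proof.
move=> d_gen dM a.
have gr1 i : grade 1 (ext_gen i) by rewrite -(cards1 i); apply: grade_e.
have gr0 : grade 0 1 by rewrite -(cards0 'I_n); apply: grade_e.
have d1 : d 1 = 0.
  by have := dM _ _ 1 gr0; rewrite !mul1r mulr1 scale1r -[LHS]addr0 => /addrI.
rewrite [a]ext_basis !linear_sum; apply: eq_bigr => S _; rewrite !linearZ /=.
congr (_ *: _); rewrite ext_e_prod; elim: (enum S) => [|i s IHs].
  by rewrite big_nil d1 bd_one.
by rewrite big_cons (dM 1%N) // bd_genM d_gen mul1r IHs expr1 scaleN1r.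
Qed.

End Grading.

Section Ideals.
Variable A : pzRingType.
Implicit Types (G I J : set A).

Definition two_sided_ideal J : Prop :=
  [/\ J 0, forall a b, J a -> J b -> J (a + b),
      forall x a, J a -> J (x * a) & forall x a, J a -> J (a * x)].

Definition ideal_gen G : set A := smallest two_sided_ideal G.

Definition annihilator I : set A :=
  [set a | forall b, I b -> a * b = 0]%classic.

End Ideals.

Section Pure.
Variables (R : comNzRingType) (n : nat).

(* The empty product 1 is pure.                                               *)
Definition pure (a : ext R n) : Prop :=
  exists2 s : seq (ext R n), (forall x, x \in s -> grade 1 x)
                           & a = \prod_(x <- s) x.

Definition pure_ideal (J : set (ext R n)) : Prop :=
  exists2 G : set (ext R n), (forall a, G a -> pure a) & J = ideal_gen G.

End Pure.

Record matroid (T : finType) := Matroid {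
  indep : pred {set T};
  indep_set0 : indep set0;
  indep_sub : forall A B : {set T}, A \subset B -> indep B -> indep A;
  indep_augment : forall A B : {set T}, indep A -> indep B -> (#|A| < #|B|)%N ->
    exists2 x, x \in B :\: A & indep (x |: A) }.

Section Matroid.
Variables (T : finType) (M : matroid T).
Implicit Types (A B C : {set T}) (x y : T).

Definition dependent A : bool := ~~ indep M A.
Definition rk A : nat := \max_(B : {set T} | (B \subset A) && indep M B) #|B|.
Definition mrank : nat := rk [set: T].
Definition circuit C : bool := minset dependent C.
Definition cl A : {set T} := [set x | rk (x |: A) == rk A].
Definition loop x : bool := circuit [set x].
Definition parallel x y : bool :=
  [&& ~~ loop x, ~~ loop y & (x == y) || circuit [set x; y]].
Definition simple_matroid : Prop :=
  (forall x, ~~ loop x) /\ (forall x y, parallel x y -> x = y).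

End Matroid.

Section NBC.
Variables (n : nat) (M : matroid 'I_n).
Implicit Types (B C T : {set 'I_n}) (p : nat).

Definition broken_circuit B : bool :=
  [exists C, circuit M C &&
    [exists i in C, [forall j in C, (i <= j)%N] && (B == C :\ i)]].
Definition nbc T : bool := [forall B, broken_circuit B ==> ~~ (B \subset T)].
Definition nbc_sets p : {set {set 'I_n}} := [set T | nbc T & #|T| == p].

(* For p > 0, flag T p is the flat spanned by the p largest elements of T;    *)
(* enum lists a set of ordinals in increasing order.                          *)
Definition flag T p : {set 'I_n} :=
  if p is 0 then set0 else cl M [set i in drop (#|T| - p)%N (enum T)].
Definition layer T p : {set 'I_n} := flag T p :\: flag T p.-1.
Definition layer_word T : seq 'I_n :=
  flatten [seq enum (layer T p) | p <- iota 1 #|T|].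

(* The default value 1 is not used when T is in nbc_sets (mrank M); see       *)
(* codom_layer_perm.                                                          *)
Definition layer_perm T : 'S_n :=
  odflt 1%g [pick s : 'S_n | codom s == layer_word T].

Definition nbc_z (R : comNzRingType) T : ext R n :=
  (-1) ^+ layer_perm T *: \prod_(1 <= p < #|T|.+1) bd (ext_e (layer T p)).

Definition OS_ideal (R : comNzRingType) : set (ext R n) :=
  ideal_gen [set a | exists2 S, dependent M S & a = bd (ext_e S)]%classic.

End NBC.
Arguments nbc_z {n} M R T.
Arguments OS_ideal {n} M R.

Section MatroidTheory.
Variables (T : finType) (M : matroid T).
Implicit Types (A B C I : {set T}) (x y : T).

Lemma rank_sub A B : A \subset B -> (rk M A <= rk M B)%N.
Proof.
move=> sAB; apply/bigmax_leqP => C /andP[sCA iC].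
by apply: leq_bigmax_cond; rewrite iC (subset_trans sCA).
Qed.

Lemma indep_rank A B : A \subset B -> indep M A -> (#|A| <= rk M B)%N.
Proof. by move=> sAB iA; apply: leq_bigmax_cond; rewrite sAB. Qed.

Lemma rank_witness A : exists2 B : {set T}, B \subset A & indep M B /\ #|B| = rk M A.
Proof.
pose P (B : {set T}) := (B \subset A) && indep M B.
have [|B PB eB] := @eq_bigmax_cond _ P (fun B : {set T} => #|B|).
  by apply/card_gt0P; exists set0; rewrite unfold_in /P sub0set indep_set0.
by exists B; [case/andP: PB|split; [case/andP: PB|]].
Qed.

Lemma indep_extend I A : I \subset A -> indep M I ->
  exists2 B : {set T}, I \subset B & [/\ B \subset A, indep M B & #|B| = rk M A].
Proof.
move=> sIA iI.
have [|B /maxsetP[/andP[sBA iB] maxB] sIB] := @maxset_exists _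
   [pred B : {set T} | (B \subset A) && indep M B] I; first by rewrite /= sIA.
exists B => //; split=> //; apply/eqP; rewrite eqn_leq indep_rank //=.
rewrite leqNgt; apply/negP; have [K sKA [iK <-]] := rank_witness A.
move=> /(indep_augment iB iK)[x /setDP[xK xB] ixB]; case/negP: xB.
rewrite -(maxB (x |: B)) ?setU11 ?subsetUr //= ixB andbT subUset sub1set sBA.
by rewrite (subsetP sKA).
Qed.

Lemma cl_sub A B : A \subset B -> cl M A \subset cl M B.
Proof.
move=> sAB; apply/subsetP => x; rewrite !inE; apply: contraLR => clB.
have [I sIA [iI cI]] := rank_witness A.
have [J sIJ [sJB iJ cJ]] := indep_extend (subset_trans sIA sAB) iI.
have [K sK [iK cK]] := rank_witness (x |: B).
have ltJK : (#|J| < #|K|)%N.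
  by rewrite cJ cK ltn_neqAle eq_sym clB rank_sub ?subsetUr.
have [y /setDP[yK yJ] iyJ] := indep_augment iJ iK ltJK.
have /setU1P[Dy|yB] := subsetP sK y yK; last first.
  have: (#|y |: J| <= rk M B)%N.
    by rewrite indep_rank // subUset sub1set yB.
  by rewrite cardsU1 yJ cJ ltnn.
rewrite {y}Dy in yJ iyJ yK *.
have xI : x \notin I by apply: contra yJ; apply/subsetP.
have: (#|x |: I| <= rk M (x |: A))%N.
  by rewrite indep_rank ?setUS //; apply: indep_sub iyJ; rewrite setUS.
by rewrite cardsU1 xI cI; apply: contraTneq => ->; rewrite ltnn.
Qed.

Lemma cl_basis A : indep M A -> #|A| = mrank M -> cl M A = [set: T].
Proof.
move=> iA cA; apply/setP => x; rewrite !inE eqn_leq.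
rewrite (rank_sub (subsetUr _ _)) andbT (leq_trans (rank_sub (subsetT _))) //.
by rewrite -/(mrank M) -cA indep_rank.
Qed.

End MatroidTheory.

Section Layers.
Variables (n : nat) (M : matroid 'I_n).
Implicit Types (T : {set 'I_n}) (p : nat).

Lemma nbc_indep T : nbc M T -> indep M T.
Proof.
move=> nbcT; apply/negPn/negP => depT.
have [C circC sCT] := @minset_exists _ (dependent M) T depT.
have [x xC] : exists x, x \in C.
  apply/set0Pn; apply: contraTneq circC => ->; apply/negP => /minsetp.
  by rewrite /dependent indep_set0.
pose i := [arg min_(j < x in C) (j : nat)].
have [iC mini] : i \in C /\ forall j, j \in C -> (i <= j)%N.
  by rewrite /i; case: arg_minnP.
have /forallP/(_ (C :\ i)) := nbcT.
rewrite (subset_trans (subsetDl _ _) sCT) implybF => /negP[].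
apply/existsP; exists C; rewrite [circuit M C]circC; apply/existsP; exists i; rewrite iC eqxx.
by rewrite andbT; apply/forall_inP.
Qed.

Lemma flag_sub T p : flag M T p \subset flag M T p.+1.
Proof.
case: p => [|p] /=; first exact: sub0set.
apply/cl_sub/subsetP => i; rewrite !inE.
have /subnK <- : (#|T| - p.+2 <= #|T| - p.+1)%N by rewrite leq_sub2l.
by rewrite -drop_drop; apply: mem_drop.
Qed.

Lemma simple_indep1 (sM : simple_matroid M) i : indep M [set i].
Proof.
apply/negPn/negP => dep_i; have [C circC] := @minset_exists _ (dependent M) _ dep_i.
rewrite subset1 => /orP[/eqP DC|/eqP C0].
  by case: sM => /(_ i) + _; rewrite /loop /circuit -DC circC.
by move: (minsetp circC); rewrite /dependent C0 indep_set0.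
Qed.

Lemma flag_full T (sM : simple_matroid M) :
  T \in nbc_sets M (mrank M) -> flag M T #|T| = [set: 'I_n].
Proof.
rewrite inE => /andP[/nbc_indep iT /eqP cT].
case DT: #|T| => [|l] /=; last first.
  rewrite -DT subnn drop0 -(cl_basis iT cT); congr (cl M _).
  by apply/setP => i; rewrite inE mem_enum.
apply/setP => i; rewrite !inE.
have := indep_rank (subsetT _) (simple_indep1 sM i).
by rewrite cards1 -/(mrank M) -cT DT.
Qed.

Lemma count_layer_word T (sM : simple_matroid M) i :
  T \in nbc_sets M (mrank M) -> count_mem i (layer_word M T) = 1%N.
Proof.
move=> /(flag_full sM) fullT; rewrite /layer_word.
suff -> q : count_mem i (flatten [seq enum (layer M T p) | p <- iota 1 q]) =
            (i \in flag M T q) by rewrite fullT inE.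
elim: q => [|q IHq]; first by rewrite inE.
have -> : iota 1 q.+1 = iota 1 q ++ [:: q.+1] by rewrite -(addn1 q) iotaD addnC.
rewrite map_cat flatten_cat count_cat {}IHq [map _ [:: _]]/= [flatten _]/=.
rewrite cats0 count_uniq_mem ?enum_uniq // mem_enum in_setD.
have /subsetP/(_ i) := flag_sub T q; rewrite -pred_Sn.
by case: (i \in flag M T q) => [->|].
Qed.

Lemma layer_wordP T (sM : simple_matroid M) :
  T \in nbc_sets M (mrank M) -> perm_eq (layer_word M T) (enum 'I_n).
Proof.
move=> nbcT; have mem_w i : i \in layer_word M T.
  by rewrite -has_pred1 has_count count_layer_word.
apply: uniq_perm => [||i]; rewrite ?enum_uniq ?mem_w ?mem_enum //.
by apply: count_mem_uniq => i; rewrite count_layer_word ?mem_w.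
Qed.

Lemma codom_layer_perm T (sM : simple_matroid M) :
  T \in nbc_sets M (mrank M) -> codom (layer_perm M T) = layer_word M T.
Proof.
move=> nbcT; rewrite /layer_perm; case: pickP => [s /eqP-> //|noS].
have perm_w := layer_wordP sM nbcT.
have size_w : size (layer_word M T) = n.
  by rewrite (perm_size perm_w) -cardE card_ord.
pose w := tcast size_w (in_tuple (layer_word M T)).
have Dw : w = layer_word M T :> seq _ by rewrite val_tcast.
have w_inj : injective (tnth w).
  by apply/tuple_uniqP; rewrite Dw (perm_uniq perm_w) enum_uniq.
have := noS (perm w_inj); rewrite codomE -Dw.
by rewrite (eq_map (permE w_inj)) map_tnth_enum eqxx.
Qed.

End Layers.

(* Main.v *)
Require Import Defs.
From mathcomp Require Import classical_sets.
From mathcomp Require Import all_boot all_algebra.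
From mathcomp Require Import zify.

(******************************************************************************)
(* The pairing (a, b) |-> coefficient of e_[n] in a b is perfect, and the nbc *)
(* monomials span E modulo I, so an element a of I^0 vanishes as soon as it   *)
(* pairs to 0 with every e_S, S nbc.                                          *)
(* Up to sign, z(T) e_B is e_[n] when B is a transversal of the layers of T,  *)
(* and it has no e_[n]-component otherwise; it is 0 if B has two elements in  *)
(* one layer. Since a set with at most one element in each layer is           *)
(* independent, z(T) kills the dependent monomials, hence, as bd z(T) = 0,    *)
(* their boundaries, so z(T) is in I^0.                                       *)
(* Let S be nbc, extended to an nbc basis T. The smallest element of each     *)
(* layer of T is its element of T, so that z(T) e_(T \ S) pairs to a unit with *)
(* e_S, and to 0 with e_S' unless S' = S or S' has a larger sum of elements.  *)
(* By triangularity, subtracting multiples of these products from any element *)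
(* of I^0 makes it pair to 0 with every nbc monomial.                         *)
(******************************************************************************)

Set Implicit Arguments.
Unset Strict Implicit.
Unset Printing Implicit Defensive.

Import GRing.Theory.
Local Open Scope ring_scope.

(** Read the top coefficients of the products [a * e_S] as coordinates of [a]. All [S] together
    determine [a] ([ext_eq0]); if [a] annihilates the Orlik-Solomon ideal, the nbc [S] suffice
    ([top_nbc0]). It is therefore enough to find, in the ideal generated by the [z(T)], a family
    that is unitriangular in the nbc coordinates: up to sign, [z(T) e_(T \ S)] for an nbc basis [T]
    containing [S] ([nbc_extend], [dual_element]). The pivots are 1, so the elimination in
    [z_ideal_approx] never divides and works over every ring.

    Two facts about the layers of [T] support this. A set meeting each layer at most once is
    independent ([transversal_indep]), which puts [z(T)] in the annihilator ([z_prod_annihilator]).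
    As [T] contains no broken circuit, its element in a layer is the smallest one there
    ([layer_min]), so [T] is the lightest full transversal ([transversal_weight]), whence
    triangularity.

    Purity comes from writing [bd e_S] as a product of differences [e_j - e_i] ([bd_e_prod]). *)

Lemma setU_setD (T : finType) (A B : {set T}) : A \subset B -> A :|: B :\: A = B.
Proof. by move=> sAB; rewrite -{1}(setIidPr sAB) setID. Qed.

(** * Exterior algebra: signs, degrees, the top pairing, purity of boundaries *)

Section ExteriorAlgebra.
Variables (R : comNzRingType) (n : nat).
Implicit Types (a b c x : ext R n) (A B L S : {set 'I_n}) (i j : 'I_n) (p q : nat).

(** Signs are never computed: being units, they affect neither vanishing nor membership in an
    ideal. *)
Definition eq_sign a b := exists k : nat, a = (-1) ^+ k *: b.

Lemma eq_sign_trans b a c : eq_sign a b -> eq_sign b c -> eq_sign a c.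
Proof. by move=> [k ->] [m ->]; exists (k + m)%N; rewrite scalerA exprD. Qed.

Lemma eq_sign_sym a b : eq_sign a b -> eq_sign b a.
Proof. by move=> [k ->]; exists k; rewrite scalerA -expr2 sqrr_sign scale1r. Qed.

Lemma eq_sign_mull c a b : eq_sign a b -> eq_sign (c * a) (c * b).
Proof. by move=> [k ->]; exists k; rewrite scalerAr. Qed.

Lemma eq_sign_mulr c a b : eq_sign a b -> eq_sign (a * c) (b * c).
Proof. by move=> [k ->]; exists k; rewrite scalerAl. Qed.

Lemma eq_sign0 a : eq_sign a 0 -> a = 0.
Proof. by move=> [k ->]; rewrite scaler0. Qed.

Lemma inversionsC A B : [disjoint A & B] ->
  (inversions A B + inversions B A = #|A| * #|B|)%N.
Proof.
move=> dAB; rewrite /inversions [X in (_ + X)%N]exchange_big /= -big_split /=.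
rewrite -sum1_card big_distrl /=; apply: eq_bigr => i iA.
rewrite mul1n -sum1_card -big_split /=; apply: eq_bigr => j jB.
have : i != j by apply: contraTneq jB => <-; rewrite (disjointFr dAB iA).
by rewrite -(inj_eq val_inj) /=; case: ltngtP.
Qed.

Lemma ext_eC A B :
  ext_e A * ext_e B = (-1) ^+ (#|A| * #|B|) *: (ext_e B * ext_e A) :> ext R n.
Proof.
rewrite !ext_e_mul disjoint_sym; case: ifP => dBA; last by rewrite scaler0.
rewrite disjoint_sym in dBA; rewrite -(inversionsC dBA) scalerA setUC.
by rewrite exprD -mulrA -expr2 sqrr_sign mulr1.
Qed.

Lemma grade_ext_eC p a B : grade p a ->
  a * ext_e B = (-1) ^+ (p * #|B|) *: (ext_e B * a).
Proof.
move=> gr_a; rewrite [a]ext_basis mulr_suml mulr_sumr scaler_sumr.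
apply: eq_bigr => A _; rewrite -scalerAl -scalerAr ext_eC.
have [->|/gr_a <-] := eqVneq (a A) 0; first by rewrite !scale0r scaler0.
by rewrite !scalerA mulrC.
Qed.

(** Elements of even degree are central. *)
Lemma ext_pairC i j a : a * (ext_gen R i * ext_gen R j) = ext_gen R i * ext_gen R j * a.
Proof.
rewrite [a]ext_basis mulr_suml mulr_sumr; apply: eq_bigr => A _.
rewrite -scalerAl -scalerAr; congr (_ *: _).
rewrite /ext_gen mulrA (ext_eC A [set i]) -scalerAl -mulrA (ext_eC A [set j]).
rewrite -scalerAr scalerA mulrA.
by rewrite !cards1 -expr2 sqrr_sign scale1r.
Qed.

Lemma grade1 : grade 0 (1 : ext R n).
Proof. by rewrite -(cards0 'I_n); apply: grade_e. Qed.

Lemma gradeZ p k a : grade p a -> grade p (k *: a).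
Proof.
move=> gr_a S; rewrite extZE => kaS; apply: gr_a.
by apply: contraNneq kaS => ->; rewrite mulr0.
Qed.

Lemma grade_sum p I (r : seq I) (P : pred I) (F : I -> ext R n) :
  (forall k, P k -> grade p (F k)) -> grade p (\sum_(k <- r | P k) F k).
Proof.
move=> grF; elim/big_rec: _ => [S|k a Pk gr_a S]; first by rewrite ext0E eqxx.
rewrite extDE; have [->|/(grF k Pk)-> //] := eqVneq (F k S) 0.
by rewrite add0r; apply: gr_a.
Qed.

Lemma gradeM p q a b : grade p a -> grade q b -> grade (p + q) (a * b).
Proof.
move=> gr_a gr_b; rewrite [a * b]/(ext_mul a b).
apply: grade_sum => A _; apply: grade_sum => B dAB.
have [-> S|/gr_a <-] := eqVneq (a A) 0.
  by rewrite mul0r mulr0 scale0r ext0E eqxx.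
have [-> S|/gr_b <-] := eqVneq (b B) 0.
  by rewrite !mulr0 scale0r ext0E eqxx.
apply: gradeZ; have [_] := leq_card_setU A B; rewrite dAB => /eqP <-.
exact: grade_e.
Qed.

Lemma grade_bd_e S : grade #|S|.-1 (bd (ext_e S) : ext R n).
Proof.
rewrite bd_on_e; apply: grade_sum => i iS; apply: gradeZ.
by rewrite (cardsD1 i) iS; apply: grade_e.
Qed.

Lemma bd_bd a : bd (bd a) = 0.
Proof.
rewrite (bd_basis a) (linear_sum (@bd R n)) big1 // => S _; rewrite linearZ /= ext_e_prod.
suff -> : bd (bd (\prod_(i <- enum S) ext_gen R i)) = 0 by rewrite scaler0.
elim: (enum S) => [|i s IHs]; first by rewrite big_nil bd_one linear0.
by rewrite big_cons bd_genM linearB /= bd_genM IHs mulr0 subr0 subrr.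
Qed.

(** Apply [bd] to [e_i e_S = 0]. *)
Lemma ext_gen_bd_e i S : i \in S -> ext_gen R i * bd (ext_e S) = ext_e S.
Proof.
move=> iS; have := bd_genM i (ext_e S : ext R n).
by rewrite ext_gen_e iS linear0 => /esym/eqP; rewrite subr_eq0 => /eqP.
Qed.

Lemma bd_e_genl i S : i \in S -> eq_sign (bd (ext_e S) * ext_gen R i) (ext_e S).
Proof.
move=> iS; rewrite /ext_gen (grade_ext_eC _ (@grade_bd_e S)).
by exists (#|S|.-1 * #|[set i]|)%N; rewrite -/(ext_gen R i) ext_gen_bd_e.
Qed.

Lemma bd_e_pair i j S : i \in S -> j \in S ->
  bd (ext_e S) * (ext_gen R i * ext_gen R j) = 0.
Proof.
move=> iS jS; rewrite mulrA; apply: eq_sign0.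
apply: eq_sign_trans (eq_sign_mulr _ (bd_e_genl iS)) _.
exists (#|S| * #|[set j]|)%N.
by rewrite ext_eC -/(ext_gen R j) ext_gen_e jS.
Qed.

Lemma bd_prod_bd I (r : seq I) (F : I -> {set 'I_n}) :
  bd (\prod_(k <- r) bd (ext_e (F k))) = 0 :> ext R n.
Proof.
elim: r => [|k r IHr]; first by rewrite big_nil bd_one.
by rewrite big_cons (bd_leibniz _ (@grade_bd_e _)) IHr bd_bd mul0r mulr0 scaler0 addr0.
Qed.

Lemma grade_prod_bd I (r : seq I) (F : I -> {set 'I_n}) :
  grade (\sum_(k <- r) #|F k|.-1) (\prod_(k <- r) bd (ext_e (F k)) : ext R n).
Proof.
elim: r => [|k r IHr]; first by rewrite !big_nil; apply: grade1.
by rewrite !big_cons; apply: gradeM IHr; apply: grade_bd_e.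
Qed.

(** The pair [e_i e_j] splits off [e_B] and, being central, moves to the factor [bd e_(F k)], which
    it kills. *)
Lemma prod_bd_e0 (I : eqType) (r : seq I) (F : I -> {set 'I_n}) k i j B :
  k \in r -> i != j -> i \in F k :&: B -> j \in F k :&: B ->
  \prod_(k <- r) bd (ext_e (F k)) * ext_e B = 0 :> ext R n.
Proof.
move=> kr nij /setIP[iF iB] /setIP[jF jB].
have eB : eq_sign (ext_e B) (ext_gen R i * ext_gen R j * ext_e (B :\ i :\ j)).
  rewrite (ext_eS R iB) -mulrA; apply: eq_sign_trans; first by eexists.
  apply: eq_sign_mull; rewrite {1}(ext_eS R (_ : j \in B :\ i)).
    by eexists.
  by rewrite !inE eq_sym nij.
apply: eq_sign0; apply: eq_sign_trans (eq_sign_mull _ eB) _; exists 0.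
rewrite scaler0 mulrA; suff -> : \prod_(k <- r) bd (ext_e (F k)) *
  (ext_gen R i * ext_gen R j) = 0 by rewrite mul0r.
elim: r kr => // m r IHr; rewrite inE big_cons -mulrA => /orP[/eqP<-|/IHr->].
  by rewrite ext_pairC mulrA bd_e_pair // mul0r.
by rewrite mulr0.
Qed.

Lemma ext_e_top A : (ext_e A * ext_e (~: A) : ext R n) setT = (-1) ^+ inversions A (~: A).
Proof.
by rewrite ext_e_mul disjoints_subset setCK subxx setUCr extZE ext_eE eqxx mulr1.
Qed.

(** Nondegeneracy of the pairing: up to sign, the coefficient of [a] at [A] is the top coefficient
    of [a * e_(~: A)]. *)
Lemma ext_eq0 a : (forall S, (a * ext_e S) setT = 0) -> a = 0.
Proof.
move=> a0; apply: extP => A; rewrite ext0E.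
have := a0 (~: A); rewrite [a in a * _]ext_basis mulr_suml ext_sumE (bigD1 A) //=.
rewrite big1 => [|B nBA].
  rewrite addr0 -scalerAl extZE ext_e_top => /(congr1 ( *%R^~ ((-1) ^+ inversions A (~: A)))).
  by rewrite mul0r -mulrA -expr2 sqrr_sign mulr1.
rewrite -scalerAl ext_e_mul extZE; case: ifP => [dB|]; last by rewrite ext0E mulr0.
rewrite extZE ext_eE; case: eqP => [eT|]; last by rewrite !mulr0.
case/eqP: nBA; apply/eqP; rewrite eqEsubset; move: dB.
rewrite disjoints_subset setCK => -> /=; apply/subsetP => i iA.
by move/setP/(_ i): eT; rewrite !inE iA orbF => <-.
Qed.

Lemma grade_gen i : grade 1 (ext_gen R i).
Proof. by rewrite -(cards1 i); apply: grade_e. Qed.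

Lemma grade_genB i j : grade 1 (ext_gen R j - ext_gen R i).
Proof.
move=> A; rewrite extDE extNE; have [->|/grade_gen //] := eqVneq (ext_gen R j A) 0.
by rewrite add0r oppr_eq0; apply: grade_gen.
Qed.

(** Since [e_i] squares to 0, each [e_j] after [e_i] may be replaced by [e_j - e_i]; these
    differences have boundary 0, so [bd] only strips off [e_i]. *)
Lemma bd_e_prod S i s : enum S = i :: s ->
  bd (ext_e S) = \prod_(j <- s) (ext_gen R j - ext_gen R i).
Proof.
move=> eS; rewrite ext_e_prod eS big_cons.
have -> : ext_gen R i * \prod_(j <- s) ext_gen R j =
          ext_gen R i * \prod_(j <- s) (ext_gen R j - ext_gen R i).
  elim: {eS} s => [|j s IHs]; first by rewrite !big_nil.
  rewrite !big_cons mulrBl mulrBr (mulrA _ (ext_gen R i)) ext_gen_sqr mul0r subr0.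
  by rewrite !mulrA ext_gen_anticomm !mulNr -!mulrA IHs.
rewrite bd_genM [X in _ * X](_ : _ = 0) ?mulr0 ?subr0 //.
elim: {eS} s => [|j s IHs]; first by rewrite big_nil bd_one.
rewrite big_cons (bd_leibniz _ (@grade_genB i j)) IHs mulr0 scaler0.
by rewrite linearB /= !bd_gen subrr mul0r addr0.
Qed.

Lemma pure1 : pure (1 : ext R n).
Proof. by exists [::]; rewrite ?big_nil. Qed.

Lemma pureM a b : pure a -> pure b -> pure (a * b).
Proof.
move=> [s gr_s ->] [t gr_t ->]; exists (s ++ t); last by rewrite big_cat.
by move=> x; rewrite mem_cat => /orP[/gr_s|/gr_t].
Qed.

Lemma pure_bd_e S : pure (bd (ext_e S) : ext R n).
Proof.
case eS: (enum S) => [|i s].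
  (* For empty [S] the boundary is 0, itself a product of one element of degree 1. *)
  exists [:: 0] => [x|].
    by rewrite inE => /eqP-> A; rewrite ext0E eqxx.
  by rewrite big_seq1 ext_e_prod eS big_nil bd_one.
exists [seq ext_gen R j - ext_gen R i | j <- s]; last by rewrite big_map (bd_e_prod eS).
by move=> x /mapP[j _ ->]; apply: grade_genB.
Qed.

Lemma pure_prod_bd I (r : seq I) (F : I -> {set 'I_n}) :
  pure (\prod_(k <- r) bd (ext_e (F k)) : ext R n).
Proof.
elim: r => [|k r IHr]; first by rewrite big_nil; apply: pure1.
by rewrite big_cons; apply: pureM IHr; apply: pure_bd_e.
Qed.

End ExteriorAlgebra.

(** * Closure, independence and circuits *)

Section Matroids.
Variables (T : finType) (M : matroid T).
Implicit Types (A B C I J : {set T}) (x y : T).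

Lemma rank_indep A : indep M A -> rk M A = #|A|.
Proof.
move=> iA; apply/eqP; rewrite eqn_leq indep_rank // andbT.
by apply/bigmax_leqP => B /andP[/subset_leq_card].
Qed.

Lemma sub_cl A : A \subset cl M A.
Proof. by apply/subsetP => x xA; rewrite inE (setUidPr _) ?sub1set. Qed.

Lemma mem_cl_dependent A x : indep M A -> x \notin A -> x \in cl M A ->
  ~~ indep M (x |: A).
Proof.
move=> iA xA; rewrite inE (rank_indep iA) => /eqP rA; apply/negP => ixA.
by have := indep_rank (subxx _) ixA; rewrite rA cardsU1 xA ltnn.
Qed.

Lemma notin_cl_indep A I x : I \subset A -> indep M I -> #|I| = rk M A ->
  x \notin cl M A -> indep M (x |: I).
Proof.
move=> sIA iI cI; rewrite inE => rA.
have [K sK [iK cK]] := rank_witness M (x |: A).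
have ltIK : (#|I| < #|K|)%N.
  by rewrite cI cK ltn_neqAle eq_sym rA rank_sub ?subsetUr.
have [y /setDP[yK yI] iyI] := indep_augment iI iK ltIK.
have /setU1P[<- //|yA] := subsetP sK y yK.
have : (#|y |: I| <= rk M A)%N by rewrite indep_rank // subUset sub1set yA.
by rewrite cardsU1 yI cI ltnn.
Qed.

Lemma rank_cl A : rk M (cl M A) = rk M A.
Proof.
apply/eqP; rewrite eqn_leq (rank_sub _ (sub_cl A)) andbT leqNgt; apply/negP.
have [I sIA [iI cI]] := rank_witness M A; rewrite -cI.
have [K sK [iK <-]] := rank_witness M (cl M A).
move=> /(indep_augment iI iK)[y /setDP[yK yI] iyI].
have := subsetP sK y yK; rewrite inE -cI => /eqP ryA.
by have := indep_rank (setUS [set y] sIA) iyI; rewrite ryA cardsU1 yI ltnn.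
Qed.

(** Extend [J] to a basis [K] of the closure and augment [K] from [x |: I], with [I] a basis of [A]:
    the new element cannot come from [I], so it is [x]. *)
Lemma indepU1_cl A J x : J \subset cl M A -> indep M J -> x \notin cl M A ->
  indep M (x |: J).
Proof.
move=> sJ iJ xA; have [I sIA [iI cI]] := rank_witness M A.
have ixI := notin_cl_indep sIA iI cI xA.
have [K sJK [sK iK cK]] := indep_extend sJ iJ; rewrite rank_cl in cK.
have xI : x \notin I.
  by apply: contra xA => /(subsetP sIA)/(subsetP (sub_cl A)).
have ltK : (#|K| < #|x |: I|)%N by rewrite cardsU1 xI cK cI.
have [y /setDP[/setU1P[->|yI] yK] iyK] := indep_augment iK ixI ltK.
  by apply: indep_sub iyK; apply: setUS.
have : (#|y |: K| <= rk M (cl M A))%N.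
  by rewrite indep_rank // subUset sub1set (subsetP (sub_cl A)) // (subsetP sIA).
by rewrite cardsU1 yK cK rank_cl ltnn.
Qed.

Lemma circuit_in A : ~~ indep M A -> exists2 C : {set T}, circuit M C & C \subset A.
Proof. by move=> dA; have [C] := @minset_exists _ (dependent M) A dA; exists C. Qed.

Lemma circuitP C : circuit M C ->
  ~~ indep M C /\ forall x, x \in C -> indep M (C :\ x).
Proof.
move=> circC; split=> [|x xC]; first exact: minsetp circC.
apply: contraLR xC => dCx.
by have <- := minsetinf circC dCx (subsetDl _ _); rewrite !inE eqxx.
Qed.

End Matroids.

(** * Extending nbc sets to bases; minima of closures *)

Section NBCSets.
Variables (n : nat) (M : matroid 'I_n).
Implicit Types (S T A B C : {set 'I_n}) (p q : nat).

Lemma nbcP T :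
  reflect (forall C i, circuit M C -> i \in C -> (forall j, j \in C -> (i <= j)%N) ->
             ~~ (C :\ i \subset T))
          (nbc M T).
Proof.
apply: (iffP forallP) => [nbcT C i circC iC miniC|nbcT B].
  have := nbcT (C :\ i); rewrite (_ : broken_circuit _ _ = true) //.
  apply/existsP; exists C; rewrite circC; apply/exists_inP; exists i => //.
  by rewrite eqxx andbT; apply/forall_inP.
apply/implyP => /existsP[C /andP[circC /exists_inP[i iC /andP[/forall_inP mini /eqP->]]]].
exact: nbcT.
Qed.

(** Take the smallest [x] that keeps [x |: S] independent. A broken circuit [C :\ i] in [x |: S]
    would have to contain [x], with [i < x], and exchanging [x] for [i] would contradict
    minimality. *)
Lemma nbc_extend1 S : nbc M S -> (#|S| < mrank M)%N ->
  exists2 x, x \notin S & nbc M (x |: S).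
Proof.
move=> nbcS ltS; have iS := nbc_indep nbcS.
have [B _ [iB cB]] := rank_witness M [set: 'I_n].
have [x0 /setDP[_ x0S] ix0S] : exists2 x, x \in B :\: S & indep M (x |: S).
  by apply: indep_augment; rewrite ?cB.
pose P x := (x \notin S) && indep M (x |: S).
have Px0 : P x0 by rewrite /P x0S.
case: (@arg_minnP _ x0 P (fun x => x : nat) Px0) => x /andP[xS ixS] minx.
exists x => //; apply/nbcP => C i circC iC mini; apply/negP => sCi.
have [dC iCD] := circuitP circC.
have niS : i \notin x |: S.
  apply: contra dC => ixs; apply: indep_sub ixS.
  by rewrite -(setD1K iC) subUset sub1set ixs.
have xC : x \in C.
  apply: contraT => xC; have /nbcP/(_ C i circC iC mini)/negP[] := nbcS.
  apply/subsetP => j jC; have /setU1P[jx|//] := subsetP sCi j jC.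
  by case/setD1P: jC => _; rewrite jx (negPf xC).
have ltix : (i < x)%N.
  rewrite ltn_neqAle mini // andbT; apply: contraNneq niS => /val_inj ->.
  exact: setU11.
have diS : ~~ indep M (i |: S).
  apply: contraL ltix => iiS; rewrite -leqNgt minx // /P iiS andbT.
  by apply: contra niS; apply: setU1r.
have sCx : C :\ x \subset i |: (x |: S).
  apply: subset_trans (subsetDl _ _) _; apply/subsetP => j jC.
  rewrite in_setU1; have [//|nji] := eqVneq j i.
  by rewrite (subsetP sCi) // !inE nji.
(* The exchange: a basis [J] containing [C :\ x] must omit [x], so by cardinality it is all of
   [i |: S]. *)
have [J sJ [sJS iJ cJ]] := indep_extend sCx (iCD x xC).
have xJ : x \notin J.
  apply: contra dC => xJ; apply: indep_sub iJ.
  by rewrite -(setD1K xC) subUset sub1set xJ.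
have sJi : J \subset i |: S.
  apply/subsetP => j jJ; have := subsetP sJS j jJ; rewrite !inE.
  by have [jx|//] := eqVneq j x; rewrite -jx jJ in xJ.
have cJle : (#|x |: S| <= #|J|)%N by rewrite cJ indep_rank // subsetUr.
case/negP: diS; suff <- : J = i |: S by [].
apply/eqP; rewrite eqEcard sJi (leq_trans _ cJle) //.
rewrite !cardsU1 xS; by case: (i \notin S).
Qed.

Lemma nbc_extend S : nbc M S ->
  exists2 T : {set 'I_n}, S \subset T & T \in nbc_sets M (mrank M).
Proof.
move Dk: (mrank M - #|S|)%N => k; elim: k S Dk => [|k IHk] S Dk nbcS.
  exists S => //; rewrite inE nbcS eqn_leq.
  by rewrite indep_rank ?subsetT ?nbc_indep //= -subn_eq0 Dk.
have [x xS nbcx] : exists2 x, x \notin S & nbc M (x |: S).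
  by apply: nbc_extend1 => //; lia.
have [|T sT nbT] := IHk (x |: S) _ nbcx; first by rewrite cardsU1 xS; lia.
by exists T => //; apply: subset_trans sT; apply: subsetUr.
Qed.

(** An element [i < t] of the closure would be the minimum of a circuit inside [i |: A], whose
    broken circuit lies in [T]. *)
Lemma nbc_cl_min T A t i : nbc M T -> A \subset T ->
  (forall j, j \in A -> (t <= j)%N) -> i \in cl M A -> (t <= i)%N.
Proof.
move=> nbcT sAT minA iclA; rewrite leqNgt; apply/negP => ltit.
have iA : indep M A by apply: indep_sub sAT (nbc_indep nbcT).
have niA : i \notin A by apply/negP => /minA; rewrite leqNgt ltit.
have [C circC sC] := circuit_in (mem_cl_dependent iA niA iclA).
have [dC _] := circuitP circC.
have iC : i \in C.
  apply: contraR dC => iC; apply: indep_sub iA; apply/subsetP => j jC.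
  by have /setU1P[ji|//] := subsetP sC j jC; rewrite -ji jC in iC.
apply: (negP ((nbcP _ nbcT) C i circC iC _)).
  move=> j /(subsetP sC)/setU1P[-> //|/minA]; apply: leq_trans; exact: ltnW.
by apply: subset_trans sAT; rewrite subDset.
Qed.

Definition tail T p : {set 'I_n} := [set i in drop (#|T| - p) (enum T)].

Lemma enum_sorted T : sorted (fun i j : 'I_n => (i < j)%N) (enum T).
Proof.
rewrite {1}/enum_mem -enumT; apply: sorted_filter.
  by move=> x y w; apply: ltn_trans.
by have := iota_ltn_sorted 0 n; rewrite -val_enum_ord sorted_map.
Qed.

Lemma tail0 T : tail T 0 = set0.
Proof. by apply/setP => i; rewrite !inE subn0 cardE drop_size. Qed.

Lemma tail_sub T p : tail T p \subset T.
Proof. by apply/subsetP => i; rewrite inE => /mem_drop; rewrite mem_enum. Qed.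

Lemma tail_card T : tail T #|T| = T.
Proof. by apply/setP => i; rewrite inE subnn drop0 mem_enum. Qed.

Lemma tailS T p : (p < #|T|)%N ->
  exists t, [/\ t \in T, t \notin tail T p, tail T p.+1 = t |: tail T p &
                forall j, j \in tail T p.+1 -> (t <= j)%N].
Proof.
move=> ltp; rewrite /tail.
have -> : (#|T| - p = (#|T| - p.+1).+1)%N by lia.
have : (#|T| - p.+1 < size (enum T))%N by rewrite -cardE; lia.
move: (#|T| - p.+1)%N => k ltk.
case: (pickP (mem T)) => [x0 _|T0]; last first.
  by rewrite (eq_card0 T0) in ltp.
have eD := drop_nth x0 ltk; move: (nth x0 (enum T) k) eD => t eD.
have lt_trans : transitive (fun i j : 'I_n => i < j)%N.
  by move=> x y w; apply: ltn_trans.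
have := drop_sorted k (enum_sorted T); rewrite eD /= => path_t.
have /allP min_t := order_path_min lt_trans path_t.
exists t; split.
- by rewrite -mem_enum (@mem_drop k) // eD mem_head.
- by rewrite inE; apply/negP => /min_t; rewrite ltnn.
- by apply/setP => i; rewrite !inE.
by move=> j; rewrite !inE => /predU1P[->|/min_t/ltnW].
Qed.

End NBCSets.

(** * Layers of an nbc basis and their transversals *)

Section LayerTheory.
Variables (n : nat) (M : matroid 'I_n) (simpleM : simple_matroid M).
Variables (T : {set 'I_n}) (nbcT : T \in nbc_sets M (mrank M)).
Implicit Types (A B : {set 'I_n}) (i j : 'I_n) (p q : nat).

Let nbc_T : nbc M T. Proof. by move: nbcT; rewrite inE => /andP[]. Qed.
Let indep_T : indep M T. Proof. exact: nbc_indep. Qed.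

Lemma flagE p : flag M T p = cl M (tail T p).
Proof.
case: p => //; rewrite tail0; apply/esym/setP => i; rewrite in_set0.
apply/negbTE/negP => /(mem_cl_dependent (indep_set0 M)).
by rewrite inE setU0 simple_indep1 // => /(_ isT).
Qed.

Lemma flag_mono p q : (p <= q)%N -> flag M T p \subset flag M T q.
Proof.
apply: (@homo_leq _ _ (fun A B => A \subset B)) => [A|B A C|r].
- exact: subxx.
- exact: subset_trans.
- exact: flag_sub.
Qed.

Lemma layer_inj p q i : (0 < p)%N -> (0 < q)%N ->
  i \in layer M T p -> i \in layer M T q -> p = q.
Proof.
move=> p0 q0 /setDP[ip ip'] /setDP[iq iq'].
case: (ltngtP p q) => // [ltpq|ltqp].
  by case/negP: iq'; apply: subsetP ip; apply: flag_mono; lia.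
by case/negP: ip'; apply: subsetP iq; apply: flag_mono; lia.
Qed.

Lemma mem_layer i : exists2 p, (p < #|T|)%N & i \in layer M T p.+1.
Proof.
have : i \in flag M T #|T| by rewrite (flag_full simpleM nbcT) inE.
elim: #|T| => [|p IHp]; first by rewrite in_set0.
have [/IHp[q ltq iq] _|ip ip'] := boolP (i \in flag M T p).
  by exists q => //; apply: ltnW.
by exists p => //; rewrite in_setD ip.
Qed.

Lemma layer_min p : (p < #|T|)%N ->
  exists t, [/\ t \in layer M T p.+1, t \notin tail T p, tail T p.+1 = t |: tail T p &
                forall j, j \in layer M T p.+1 -> (t <= j)%N].
Proof.
move=> ltp; have [t [tT tp Dp mint]] := tailS ltp; exists t; split => //; last first.
  move=> j /setDP[+ _]; rewrite flagE.
  exact: (nbc_cl_min nbc_T (tail_sub _ _) mint).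
rewrite in_setD !flagE; apply/andP; split; last first.
  by apply: (subsetP (sub_cl M _)); rewrite Dp setU11.
apply/negP => /mem_cl_dependent; rewrite (indep_sub (tail_sub _ _)) // tp => /(_ isT isT).
by rewrite -Dp (indep_sub (tail_sub _ _)).
Qed.

(** Partial transversals: [B] may miss layers. *)
Definition transversal_to B :=
  forall p i j, (p < #|T|)%N -> i \in layer M T p.+1 :&: B ->
    j \in layer M T p.+1 :&: B -> i = j.

(** Climb the flags: the element of [B] in a new layer lies outside the previous flag, which is
    closed, so [indepU1_cl] adds it. *)
Lemma transversal_indep B : transversal_to B -> indep M B.
Proof.
move=> trB; suff iB p : (p <= #|T|)%N -> indep M (B :&: flag M T p).
  by have := iB _ (leqnn _); rewrite (flag_full simpleM nbcT) setIT.
elim: p => [|p IHp] ltp; first by rewrite setI0 indep_set0.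
have [noB|[x xB]] := set_0Vmem (layer M T p.+1 :&: B).
  suff -> : B :&: flag M T p.+1 = B :&: flag M T p by apply: IHp; apply: ltnW.
  apply/setP => i; rewrite !in_setI.
  have [iB|//] := boolP (i \in B); rewrite !andTb.
  have := in_set0 i; rewrite -noB in_setI iB andbT in_setD.
  have /subsetP/(_ i) := flag_sub M T p.
  by rewrite -pred_Sn; case: (i \in flag M T p); case: (i \in _) => // /(_ isT).
suff -> : B :&: flag M T p.+1 = x |: (B :&: flag M T p).
  apply: (@indepU1_cl _ _ (tail T p)); rewrite -?flagE ?subsetIr ?IHp //.
    exact: ltnW.
  by move: xB => /setIP[/setDP[]].
have xl := xB; move: xl => /setIP[/setDP[xp xp'] x_B].
apply/setP => i; rewrite in_setU1 !in_setI.
have [->|nix] := eqVneq i x; first by rewrite x_B xp.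
have [iB|//] := boolP (i \in B); rewrite /= -/(flag M T p.+1).
apply/idP/idP => [ip|]; last exact: (subsetP (flag_sub M T p)).
apply: contraNT nix => ip'; apply/eqP.
by apply: (trB p) => //; rewrite in_setI iB andbT in_setD ip' ip.
Qed.

(** Orders the triangular system, and is the measure that decreases when monomials are rewritten
    into nbc ones. *)
Definition weight A : nat := \sum_(i in A) i.

Lemma weightU A B : [disjoint A & B] -> weight (A :|: B) = (weight A + weight B)%N.
Proof.
by move=> dAB; rewrite /weight -bigU //; apply: eq_bigl => i; rewrite in_setU.
Qed.

Lemma weight_sub A B : A \subset B -> (weight A <= weight B)%N.
Proof.
move=> sAB; rewrite -(setU_setD sAB) weightU ?leq_addr //.
by rewrite disjoint_sym disjoints_subset subsetDr.
Qed.

(** Sending each element of [B] to the minimum of its layer is a bijection onto [T] that never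
    increases an element. *)
Lemma transversal_weight B : transversal_to B -> #|B| = #|T| ->
  (weight T < weight B)%N \/ B = T.
Proof.
move=> trB cB.
have lam i : exists t : 'I_n, [/\ t \in T, (t <= i)%N &
    exists2 p, (p < #|T|)%N & (i \in layer M T p.+1) && (t \in layer M T p.+1)].
  have [p ltp ip] := mem_layer i; have [t [tp _ Dp mint]] := layer_min ltp.
  exists t; split; [|exact: mint|by exists p; rewrite // ip].
  by apply: (subsetP (tail_sub T p.+1)); rewrite Dp setU11.
have {lam} [f fP] := fin_all_exists lam.
have finj : {in B &, injective f}.
  move=> i j iB jB eqf.
  have [_ _ [p ltp /andP[ip fip]]] := fP i.
  have [_ _ [q ltq /andP[jq fjq]]] := fP j.
  have epq : p.+1 = q.+1 by apply: layer_inj fip _ => //; rewrite eqf.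
  by apply: (trB p) => //; rewrite inE ?ip ?iB // epq jq jB.
have fB : f @: B = T.
  apply/eqP; rewrite eqEcard card_in_imset // cB leqnn andbT.
  by apply/subsetP => _ /imsetP[i _ ->]; have [] := fP i.
have wT : weight T = (\sum_(i in B) f i)%N.
  by rewrite /weight -[in LHS]fB big_imset.
have [/forall_inP eqf|] := boolP [forall (i | i \in B), f i == i].
  right; apply/eqP; rewrite eqEcard cB leqnn andbT; apply/subsetP => i iB.
  by rewrite -(eqP (eqf i iB)); have [] := fP i.
rewrite negb_forall_in => /exists_inP[i iB nfi]; left.
rewrite wT /weight (bigD1 i) //= [X in (_ < X)%N](bigD1 i) //= -addSn leq_add //.
  by rewrite ltn_neqAle nfi; have [] := fP i.
by apply: leq_sum => j _; have [] := fP j.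
Qed.

End LayerTheory.

(** * Generated ideals and annihilators *)

Section TwoSidedIdeals.
Variable A : pzRingType.
Implicit Types (G H I J : set A).

Lemma ideal_genP G : two_sided_ideal (ideal_gen G).
Proof.
split=> [J [[]] //|a b Ga Gb J JG|x a Ga J JG|x a Ga J JG].
- by case: (JG) => -[_ addJ _ _] _; apply: addJ; [apply: Ga|apply: Gb].
- by case: (JG) => -[_ _ mulJ _] _; apply: mulJ; apply: Ga.
- by case: (JG) => -[_ _ _ mulJ] _; apply: mulJ; apply: Ga.
Qed.

Lemma mem_ideal_gen G a : G a -> ideal_gen G a.
Proof. by move=> Ga J [_]; apply. Qed.

Lemma ideal_gen_sub G J : two_sided_ideal J -> (forall a, G a -> J a) ->
  forall a, ideal_gen G a -> J a.
Proof. by move=> idJ sGJ a; apply; split. Qed.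

Lemma ideal_gen_eq G H : (forall a, G a -> ideal_gen H a) ->
  (forall a, H a -> ideal_gen G a) -> ideal_gen G = ideal_gen H.
Proof.
move=> sGH sHG; apply/seteqP; split=> a.
  by apply: ideal_gen_sub => //; apply: ideal_genP.
by apply: ideal_gen_sub => //; apply: ideal_genP.
Qed.

Lemma annihilator_ideal I : two_sided_ideal I -> two_sided_ideal (annihilator I).
Proof.
move=> [_ _ mulI _]; split=> [b _|a b Aa Ab c Ic|x a Aa b Ib|x a Aa b Ib].
- exact: mul0r.
- by rewrite mulrDl Aa // Ab // addr0.
- by rewrite -mulrA Aa // mulr0.
- by rewrite -mulrA Aa //; apply: mulI.
Qed.

Lemma ideal_sum J (K : finType) (P : pred K) (F : K -> A) : two_sided_ideal J ->
  (forall k, P k -> J (F k)) -> J (\sum_(k | P k) F k).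
Proof. by move=> [J0 JD _ _] JF; elim/big_ind: _. Qed.

End TwoSidedIdeals.

(** * The annihilator of the Orlik-Solomon ideal *)

Section Annihilator.
Variables (R : comNzRingType) (n : nat) (M : matroid 'I_n).
Hypothesis simpleM : simple_matroid M.
Implicit Types (a b x : ext R n) (S T B : {set 'I_n}).

Local Notation OS := (OS_ideal M R).

Lemma OS_two_sided : two_sided_ideal OS.
Proof. exact: ideal_genP. Qed.

Lemma ideal_scale (J : set (ext R n)) k a : two_sided_ideal J -> J a -> J (k *: a).
Proof. by move=> [_ _ mulJ _] Ja; rewrite -[a]mul1r scalerAl; apply: mulJ. Qed.

(* nbc_z without its sign. A product of bd (ext_e L) is pure, but its opposite *)
(* need not be: with singleton layers, nbc_z can be -1.                       *)
Definition z_prod T : ext R n :=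
  \prod_(1 <= p < #|T|.+1) bd (ext_e (layer M T p)).

Lemma nbc_z_sign T : eq_sign (nbc_z M R T) (z_prod T).
Proof. by eexists. Qed.

Lemma z_prod_grade T : exists d, grade d (z_prod T).
Proof. by eexists; apply: grade_prod_bd. Qed.

Lemma z_prod_transversal T B : z_prod T * ext_e B != 0 -> transversal_to M T B.
Proof.
move=> zB p i j ltp iLB jLB; apply: contraNeq zB => nij.
by rewrite (@prod_bd_e0 _ _ _ _ _ p.+1 i j) // mem_index_iota.
Qed.

Section Base.
Variables (T : {set 'I_n}) (nbcT : T \in nbc_sets M (mrank M)).

(** In each layer [L] the element of [T] turns [bd e_L] into [e_L] up to sign, and the layers
    reassemble into flags. *)
Lemma z_prod_top : eq_sign (z_prod T * ext_e T) (ext_e [set: 'I_n]).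
Proof.
suff zq q : (q <= #|T|)%N -> eq_sign
    (\prod_(1 <= p < q.+1) bd (ext_e (layer M T p)) * ext_e (tail T q) : ext R n)
    (ext_e (flag M T q)).
  by have := zq _ (leqnn _); rewrite tail_card (flag_full simpleM nbcT).
elim: q => [_|q IHq ltq].
  by rewrite big_geq // mul1r tail0; exists 0; rewrite scale1r.
have [t [tL tq Dq _]] := layer_min simpleM nbcT ltq.
rewrite big_nat_recr //= -/(layer M T q.+1) -/(flag M T q.+1).
set P := \prod_(_ <= _ < _) _; set L := layer M T q.+1 in tL *.
have Dt : tail T q.+1 :\ t = tail T q by rewrite Dq setU1K.
have tT : t \in tail T q.+1 by rewrite Dq setU11.
rewrite (ext_eS R tT) Dt -scalerAr.
apply: eq_sign_trans; first by eexists.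
rewrite mulrA -(mulrA P).
apply: eq_sign_trans; first exact: eq_sign_mulr (eq_sign_mull _ (bd_e_genl R tL)).
(* Move [e_L] to the far right, so that the induction hypothesis applies to the remaining
   factors. *)
rewrite -mulrA (ext_eC _ L) -scalerAr mulrA.
apply: eq_sign_trans; first by eexists.
apply: eq_sign_trans; first exact: eq_sign_mulr (IHq (ltnW ltq)).
have dqL : [disjoint flag M T q & L] by rewrite disjoint_sym disjoints_subset subsetDr.
have -> : flag M T q.+1 = flag M T q :|: L.
  by rewrite setU_setD // flag_sub.
by rewrite ext_e_mul dqL; eexists.
Qed.

Lemma z_prod_annihilator : annihilator OS (z_prod T).
Proof.
have [d gr_z] := z_prod_grade T.
(* The factor [c] in the middle makes [J] a left ideal as well as a right one. *)
pose J : set (ext R n) := fun b => forall c, z_prod T * c * b = 0.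
have idJ : two_sided_ideal J.
  split=> [c|b b' Jb Jb' c|x b Jb c|x b Jb c].
  - exact: mulr0.
  - by rewrite mulrDr Jb Jb' addr0.
  - by rewrite mulrA -(mulrA (z_prod T)) Jb.
  - by rewrite mulrA Jb mul0r.
suff OSJ b : OS b -> J b by move=> b /OSJ/(_ 1); rewrite mulr1.
apply: (ideal_gen_sub idJ) => _ [S dS ->] c.
have z_dS : z_prod T * bd (ext_e S) = 0.
  have z_S : z_prod T * ext_e S = 0.
    apply/eqP; apply: contraNT dS => /z_prod_transversal.
    exact: transversal_indep.
  (* Take the boundary of [z e_S = 0]; as [bd z = 0], only [z * bd e_S] remains. *)
  have /esym := bd_leibniz (ext_e S) gr_z.
  rewrite z_S linear0 bd_prod_bd mul0r add0r => eq0.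
  by apply: eq_sign0; rewrite -eq0; apply: eq_sign_sym; eexists.
rewrite [c]ext_basis (mulr_sumr _ _ _ (z_prod T)) mulr_suml big1 // => C _.
rewrite -scalerAr -scalerAl -mulrA; have := grade_ext_eC C (@grade_bd_e R n S).
move/(congr1 ( *%R (z_prod T))); rewrite mulrA z_dS mul0r -scalerAr => /esym eq0.
suff -> : z_prod T * (ext_e C * bd (ext_e S)) = 0 by rewrite scaler0.
by apply: eq_sign0; rewrite -eq0; apply: eq_sign_sym; eexists.
Qed.

End Base.

Definition z_ideal : set (ext R n) :=
  ideal_gen (z_prod @` [set T | T \in nbc_sets M (mrank M)])%classic.

Lemma z_ideal_sub a : z_ideal a -> annihilator OS a.
Proof.
apply: ideal_gen_sub; first exact/annihilator_ideal/OS_two_sided.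
by move=> _ [T nbcT <-]; apply: z_prod_annihilator.
Qed.

(** If [z(T) e_(T \ S)] pairs nontrivially with [e_S'], then [T \ S] and [S'] form a full
    transversal, and its weight is compared with that of [T]. *)
Lemma dual_element S : nbc M S -> exists w, [/\ z_ideal w,
  (w * ext_e S) [set: 'I_n] = 1 &
  forall S', (w * ext_e S') [set: 'I_n] != 0 -> S' = S \/ (weight S < weight S')%N].
Proof.
move=> nbcS; have [T sST nbcT] := nbc_extend nbcS.
have dT : [disjoint T :\: S & S] by rewrite disjoints_subset subsetDr.
have [k Dk] : eq_sign (z_prod T * ext_e (T :\: S) * ext_e S) (ext_e [set: 'I_n]).
  rewrite -mulrA ext_e_mul dT setUC setU_setD // -scalerAr.
  by apply: eq_sign_trans (z_prod_top nbcT); eexists.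
exists ((-1) ^+ k *: (z_prod T * ext_e (T :\: S))); split.
- apply: (ideal_scale _ (J := z_ideal)); first exact: ideal_genP.
  have [_ _ _ mulJ] := ideal_genP (z_prod @` [set T | T \in nbc_sets M (mrank M)])%classic.
  by apply: mulJ; apply: mem_ideal_gen; exists T.
- by rewrite -scalerAl Dk scalerA -expr2 sqrr_sign scale1r ext_eE eqxx.
move=> S'; rewrite -scalerAl extZE -mulrA ext_e_mul.
case: ifP => [dS'|_]; last by rewrite mulr0 ext0E mulr0 eqxx.
rewrite -scalerAr extZE; set B := _ :|: S' => nz.
have {nz} topB : (z_prod T * ext_e B) [set: 'I_n] != 0.
  by apply: contraNneq nz => ->; rewrite !mulr0.
have trB : transversal_to M T B.
  by apply: z_prod_transversal; apply: contraNneq topB => ->; rewrite ext0E.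
(* [z_prod T] is homogeneous, and both [e_B] and [e_T] bring it to the top degree. *)
have cB : #|B| = #|T|.
  have [d gr_z] := z_prod_grade T.
  have topT : (z_prod T * ext_e T) [set: 'I_n] != 0.
    have [m ->] := z_prod_top nbcT.
    rewrite extZE ext_eE eqxx mulr1; apply/eqP => m0.
    by have := sqrr_sign R m; rewrite m0 expr0n => /esym/eqP; rewrite oner_eq0.
  have := gradeM gr_z (@grade_e R n B) topB.
  by rewrite (gradeM gr_z (@grade_e R n T) topT) => /addnI.
have wB : weight B = (weight (T :\: S) + weight S')%N by apply: weightU.
have wT : weight T = (weight (T :\: S) + weight S)%N.
  by rewrite -[in LHS](setU_setD sST) setUC; apply: weightU.
have [|BT] := transversal_weight simpleM nbcT trB cB.
  by rewrite wB wT ltn_add2l; right.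
left; apply/setP => i; have /setP/(_ i) := BT.
have /subsetP/(_ i) := sST; have := disjointFr dS' (x := i).
rewrite !inE; case: (i \in S); case: (i \in T) => //=; case: (i \in S') => //.
by move=> _ /(_ isT).
Qed.

(* The nbc monomials span the algebra modulo OS: if S contains the broken     *)
(* circuit C :\ i, the relation bd e_(i |: S) rewrites e_S into dependent      *)
(* monomials and monomials in which i replaces a larger element.              *)
Lemma top_nbc0 a : annihilator OS a ->
  (forall S, nbc M S -> (a * ext_e S) [set: 'I_n] = 0) -> a = 0.
Proof.
move=> Aa a0; apply: ext_eq0 => S.
have OSd C : ~~ indep M C -> OS (bd (ext_e C)).
  by move=> dC; apply: mem_ideal_gen; exists C.
(* Dependent monomials lie in the ideal, as [e_C = e_i * bd e_C]. *)
have dep0 C : ~~ indep M C -> a * ext_e C = 0.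
  move=> dC; have [i iC] : exists i, i \in C.
    by apply/set0Pn; apply: contraNneq dC => ->; apply: indep_set0.
  rewrite -(ext_gen_bd_e R iC) Aa //.
  by have [_ _ mulI _] := OS_two_sided; apply: mulI; apply: OSd.
have [m] := ubnP (weight S); elim: m S => // m IHm S ltS.
have [/a0 //|nnbcS] := boolP (nbc M S).
have [iS|/dep0-> //] := boolP (indep M S); last exact: ext0E.
have [C [i [circC iC mini sCS]]] : exists C : {set 'I_n}, exists i, [/\ circuit M C, i \in C,
    forall j, j \in C -> (i <= j)%N & C :\ i \subset S].
  move: nnbcS; rewrite /nbc negb_forall => /existsP[B].
  rewrite negb_imply negbK => /andP[/existsP[C]].
  move=> /andP[circC /exists_inP[i iC /andP[/forall_inP mini /eqP->]]] sCS.
  by exists C, i.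
have [dC _] := circuitP circC.
have sCU : C \subset i |: S by rewrite -subDset.
have niS : i \notin S.
  apply: contra dC => i_S; apply: indep_sub iS.
  by rewrite (setUidPr _) ?sub1set in sCU.
have dU : ~~ indep M (i |: S) by apply: contra dC; apply: indep_sub.
have := congr1 (fun b : ext R n => b [set: 'I_n]) (Aa _ (OSd _ dU)).
rewrite /= bd_on_e bd_eE big_setU1 //= setU1K // mulrDr extDE ext0E.
rewrite mulr_sumr [X in _ + X]ext_sumE [X in _ + X]big1 => [|j jS].
  rewrite addr0 -scalerAr extZE => /(congr1 ( *%R ((-1) ^+ inversions [set i] S))).
  by rewrite mulr0 mulrA -expr2 sqrr_sign mul1r.
rewrite -scalerAr extZE; suff -> : (a * ext_e ((i |: S) :\ j)) [set: 'I_n] = 0.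
  by rewrite mulr0.
have [jC|njC] := boolP (j \in C).
  apply: IHm; rewrite ltnS in ltS; apply: leq_trans ltS.
  have ltij : (i < j)%N.
    rewrite ltn_neqAle mini // andbT; apply: contraNneq niS => /val_inj->.
    exact: jS.
  have : (weight (i |: S) = i + weight S)%N by apply: big_setU1.
  have : (weight (i |: S) = j + weight ((i |: S) :\ j))%N.
    by apply: big_setD1; rewrite inE jS orbT.
  lia.
rewrite dep0 ?ext0E //; apply: contra dC; apply: indep_sub.
by rewrite subsetD1 sCU.
Qed.

(* Triangular elimination against the dual elements, by increasing weight.    *)
Lemma z_ideal_approx k a : annihilator OS a ->
  exists2 b, z_ideal b & forall S, nbc M S -> (weight S < k)%N ->
    ((a - b) * ext_e S) [set: 'I_n] = 0.
Proof.
move=> Aa; have idZ : two_sided_ideal z_ideal by apply: ideal_genP.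
have wP S : exists w : ext R n, nbc M S -> [/\ z_ideal w,
    (w * ext_e S) [set: 'I_n] = 1 & forall S', (w * ext_e S') [set: 'I_n] != 0 ->
      S' = S \/ (weight S < weight S')%N].
  by have [/dual_element[w wS]|] := boolP (nbc M S); [exists w|exists 0].
have {wP} [w wP] := fin_all_exists wP.
elim: k => [|k [b Zb bP]]; first by exists 0 => //; case: idZ.
(* All nbc sets of weight [k] are corrected at once: their dual elements vanish on each other and on
   lighter sets. *)
pose c S := ((a - b) * ext_e S) [set: 'I_n].
exists (b + \sum_(S | nbc M S && (weight S == k)) c S *: w S).
  have [_ ZD _ _] := idZ; apply: ZD => //; apply: ideal_sum => // S /andP[/wP[Zw _ _] _].
  exact: (ideal_scale _ (J := z_ideal)).
move=> S nbcS; rewrite ltnS leq_eqVlt opprD addrA mulrBl extDE extNE.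
have top_w S' : nbc M S' -> S != S' -> (weight S <= weight S')%N ->
    (w S' * ext_e S) [set: 'I_n] = 0.
  move=> nbcS' nSS' leSS'; apply/eqP; apply: contraNT nSS'.
  have [_ _ wS'] := wP S' nbcS'.
  by case/wS' => [->//|]; rewrite ltnNge leSS'.
rewrite (mulr_suml _ _ (fun S' => c S' *: w S')) [X in _ - X]ext_sumE => /predU1P[wS|ltS].
  rewrite (bigD1 S) /= ?nbcS ?wS ?eqxx // -scalerAl extZE.
  have [_ -> _] := wP S nbcS; rewrite mulr1 big1 ?addr0 ?subrr // => S'.
  move=> /andP[/andP[nbcS' /eqP wS'] nS'].
  by rewrite -scalerAl extZE top_w ?mulr0 1?eq_sym // wS wS'.
rewrite bP // big1 ?subrr // => S' /andP[nbcS' /eqP wS'].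
rewrite -scalerAl extZE top_w ?mulr0 // ?wS' ?(ltnW ltS) //.
by apply: contraTneq ltS => ->; rewrite wS' ltnn.
Qed.

Lemma z_idealE : z_ideal = annihilator OS.
Proof.
apply/seteqP; split=> [|a Aa]; first exact: z_ideal_sub.
(* This bound exceeds the weight of every set, so every nbc coordinate of [a - b] vanishes. *)
have [b Zb bP] := z_ideal_approx (weight [set: 'I_n]).+1 Aa.
have [_ AD mulA _] := annihilator_ideal OS_two_sided.
suff /eqP : a - b = 0 by rewrite subr_eq0 => /eqP->.
apply: top_nbc0 => [|S nbcS].
  by apply: AD => //; rewrite -mulN1r; apply/mulA/z_ideal_sub.
by apply: bP => //; rewrite ltnS; apply/weight_sub/subsetT.
Qed.

Lemma nbc_z_ideal :
  ideal_gen (nbc_z M R @` [set T | T \in nbc_sets M (mrank M)])%classic = z_ideal.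
Proof.
have signP G a b : eq_sign a b -> ideal_gen G b -> ideal_gen (G : set (ext R n)) a.
  by move=> [k ->] Gb; apply: ideal_scale (ideal_genP G) Gb.
apply: ideal_gen_eq => _ [T nbcT <-].
  by apply: signP (nbc_z_sign T) _; apply: mem_ideal_gen; exists T.
by apply: signP (eq_sign_sym (nbc_z_sign T)) _; apply: mem_ideal_gen; exists T.
Qed.

End Annihilator.

Theorem corollary3p4 (R : comNzRingType) (n l : nat) (M : matroid 'I_n)
    (simpleM : simple_matroid M) (rankM : mrank M = l) :
  ideal_gen (nbc_z M R @` [set T | T \in nbc_sets M l])%classic
    = annihilator (OS_ideal M R) /\
  pure_ideal (annihilator (OS_ideal M R)).
Proof.
rewrite -rankM nbc_z_ideal (z_idealE _ simpleM); split=> //.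
exists (@z_prod R n M @` [set T | T \in nbc_sets M (mrank M)])%classic.
  by move=> _ [T _ <-]; apply: pure_prod_bd.
by rewrite -(z_idealE _ simpleM).
Qed.
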